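(* Let $p\ge 2$, let $\alpha_1,\dots,\alpha_p>-1$ be real numbers with $\alpha_i-\alpha_j\notin\mathbb Z$ for $i\ne j$, and let $\vec n=(n_1,\dots,n_p)\in\mathbb N_0^p$ with $|\vec n|=n_1+\cdots+n_p\ge1$. Then the type I Laguerre multiple orthogonal polynomials of the first kind $L^{(1)}_{\vec n},\dots,L^{(p)}_{\vec n}$, i.e. the polynomials with $\deg L^{(i)}_{\vec n}\le n_i-1$ satisfying $$\sum_{i=1}^p\int_0^\infty x^jL^{(i)}_{\vec n}(x)\,e^{-x}x^{\alpha_i}\,dx=\begin{cases}0,& j\in\{0,\dots,|\vec n|-2\},\\ 1,& j=|\vec n|-1,\end{cases}$$ are given, for $i\in\{1,\dots,p\}$, by $$L^{(i)}_{\vec n}(x)=(-1)^{|\vec n|-1}\frac{1}{(n_i-1)!\,\prod_{k=1,\,k\ne i}^p(\alpha_k-\alpha_i)_{n_k}\;\Gamma(\alpha_i+1)}\;{}_pF_p\!\left[\begin{matrix}-n_i+1,\ (\alpha_i+1-\alpha_k-n_k)_{k\ne i}\\ \alpha_i+1,\ (\alpha_i+1-\alpha_k)_{k\ne i}\end{matrix};x\right].$$ Moreover, these polynomials are obtained from the type I Jacobi--Piñeiro polynomials $P^{(i)}_{\vec n}(\,\cdot\,;\alpha_1,\dots,\alpha_p,\beta)$ through the limit $$L^{(i)}_{\vec n}(x)=\lim_{\beta\to\infty}\frac{\Gamma(\beta+|\vec n|)}{\prod_{k=1}^p(\alpha_k+\beta+|\vec n|)_{n_k}\,\Gamma(\alpha_i+\beta+|\vec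 n|)}\;P^{(i)}_{\vec n}\!\left(\frac{x}{\beta};\alpha_1,\dots,\alpha_p,\beta\right).$$
   Context: $\mathbb N_0=\{0,1,2,\dots\}$. The Pochhammer symbol is $(x)_0=1$, $(x)_n=x(x+1)\cdots(x+n-1)$ for $n\ge1$. The generalized hypergeometric series is ${}_rF_s\left[\begin{matrix}a_1,\dots,a_r\\ c_1,\dots,c_s\end{matrix};x\right]=\sum_{l=0}^\infty\frac{(a_1)_l\cdots(a_r)_l}{(c_1)_l\cdots(c_s)_l}\frac{x^l}{l!}$. In the hypergeometric series, $(\alpha_i+1-\alpha_k-n_k)_{k\ne i}$ denotes the list of the $p-1$ parameters $\alpha_i+1-\alpha_k-n_k$, $k\in\{1,\dots,p\}\setminus\{i\}$ (not a Pochhammer symbol), and similarly $(\alpha_i+1-\alpha_k)_{k\ne i}$. A polynomial of degree $\le-1$ is the zero polynomial; when $n_i=0$ the factor $1/(n_i-1)!$ is read as $0$, so that $L^{(i)}_{\vec n}=0$ and $P^{(i)}_{\vec n}=0$. Under the stated conditions on $\alpha_1,\dots,\alpha_p$, the weights $e^{-x}x^{\alpha_1},\dots,e^{-x}x^{\alpha_p}$ with the measure $dx$ on $[0,\infty)$ form an AT system, so the type I polynomials exist and are uniquely determined by the degree and orthogonality conditions. The type I Jacobi--Piñeiro polynomials, for $\beta>-1$ and the same $\alpha_k$ and $\vec n$, are the polynomials with $\deg P^{(i)}_{\vec n}\le n_i-1$ satisfying $\sum_{i=1}^p\int_0^1x^jP^{(i)}_{\vec n}(x)x^{\alpha_i}(1-x)^\beta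 dx=0$ for $0\le j\le|\vec n|-2$ and $=1$ for $j=|\vec n|-1$; explicitly $$P^{(i)}_{\vec n}(x;\alpha_1,\dots,\alpha_p,\beta)=(-1)^{|\vec n|-1}\frac{\prod_{k=1}^p(\alpha_k+\beta+|\vec n|)_{n_k}}{(n_i-1)!\prod_{k=1,\,k\ne i}^p(\alpha_k-\alpha_i)_{n_k}}\cdot\frac{\Gamma(\alpha_i+\beta+|\vec n|)}{\Gamma(\beta+|\vec n|)\,\Gamma(\alpha_i+1)}\;{}_{p+1}F_p\!\left[\begin{matrix}-n_i+1,\ \alpha_i+\beta+|\vec n|,\ (\alpha_i+1-\alpha_k-n_k)_{k\ne i}\\ \alpha_i+1,\ (\alpha_i+1-\alpha_k)_{k\ne i}\end{matrix};x\right].$$ *)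

(* Defs.v *)
From HB Require Import structures.
From mathcomp Require Import all_boot all_order all_algebra.
From mathcomp Require Import all_classical all_reals all_analysis.
Set Implicit Arguments.
Unset Strict Implicit.
Unset Printing Implicit Defensive.
Import Order.TTheory GRing.Theory Num.Theory.
Import numFieldNormedType.Exports.
Local Open Scope classical_set_scope.
Local Open Scope ring_scope.

(* Euler's integral; it is the Gamma function for 0 < z only. *)
Definition Gamma (R : realType) (z : R) : R :=
  \int[@lebesgue_measure R]_(t in `[0, +oo[) (t `^ (z - 1) * expR (- t)).

Definition pochhammer (R : realType) (x : R) (n : nat) : R :=
  \prod_(0 <= m < n) (x + m%:R).

(* [a] and [c] list the upper and the lower parameters.  As [x / 0 = 0] and
   [limn] is total, this is meaningful only when no lower parameter is in
   {0, -1, -2, ...} and the series converges. *)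
Definition hypergeometric (R : realType) (a c : seq R) (x : R) : R :=
  limn (series (fun l : nat =>
    (\prod_(u <- a) pochhammer u l) / (\prod_(v <- c) pochhammer v l)
      * (x ^+ l / l`!%:R))).

(* 1 / (n - 1)!, read as 0 when n = 0 *)
Definition inv_fact_pred (R : realType) (n : nat) : R :=
  if n is m.+1 then (m`!%:R)^-1 else 0.

Definition multi_size (p : nat) (n : 'I_p -> nat) : nat := (\sum_(i < p) n i)%N.

(* [L] is a system of type I multiple orthogonal polynomials of multi-index [n]
   for the weights [w i] on [D].  The degree bound deg (L i) <= n i - 1 is
   [size (L i) <= n i], which forces [L i = 0] when [n i = 0]. *)
Definition typeI (R : realType) (p : nat) (D : set R) (w : 'I_p -> R -> R)
    (n : 'I_p -> nat) (L : 'I_p -> {poly R}) : Prop :=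
  (forall i, (size (L i) <= n i)%N) /\
  (forall j : nat, (j < multi_size n)%N ->
     \sum_(i < p) \int[@lebesgue_measure R]_(x in D)
        (x ^+ j * (L i).[x] * w i x)
     = (if j == (multi_size n).-1 then 1 else 0)).

(* The convention [0 `^ a = 0] for [a != 0] only affects the weights at the
   endpoints of the intervals below, hence not the integrals. *)
Definition laguerre_typeI (R : realType) (p : nat) (alpha : 'I_p -> R)
    (n : 'I_p -> nat) (L : 'I_p -> {poly R}) : Prop :=
  typeI `[0, +oo[ (fun i x => expR (- x) * x `^ alpha i) n L.

Definition jacobi_pineiro_typeI (R : realType) (p : nat) (alpha : 'I_p -> R)
    (beta : R) (n : 'I_p -> nat) (P : 'I_p -> {poly R}) : Prop :=
  typeI `[0, 1] (fun i x => x `^ alpha i * (1 - x) `^ beta) n P.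

(* Main.v *)
(* With nodes y = alpha_i + l (0 <= l < n_i), of which there are N = |n|, the
   Laguerre moments are Gamma(y + 1) (y + 1)_j, so the orthogonality conditions
   say that the rescaled coefficients d_y = c_{i,l} Gamma(y + 1) satisfy
   sum_y d_y q(y) = [X^(N-1)] q for q = (X + 1)_j, j < N.  As the nodes are
   distinct, Lagrange interpolation forces d_y = 1 / prod_{y' <> y} (y - y').
   The Jacobi-Pineiro moments lead in the same way to the polynomials
   q_j = (X + 1)_j (X + beta + j + 2)_(N-1-j), all of which but the last one
   vanish at w = - beta - N; the solution is then proportional to
   1 / ((y - w) prod_{y' <> y} (y - y')).  Hence each Jacobi-Pineiro coefficient
   is, up to the prefactor in the limit, (alpha_i + beta + N)_l times the
   Laguerre coefficient, and (alpha_i + beta + N)_l / beta^l tends to 1. *)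
Require Import Defs.
From HB Require Import structures.
From mathcomp Require Import all_boot all_order all_algebra.
From mathcomp Require Import all_classical all_reals all_analysis.
From mathcomp Require Import measurable_realfun lra ring zify.
Import Order.TTheory GRing.Theory Num.Theory.
Import numFieldNormedType.Exports.
Local Open Scope classical_set_scope.
Local Open Scope ring_scope.

(** * Affine change of variables *)

Section change_of_variables.
Context {R : realType}.
Local Notation mu := (@lebesgue_measure R).

Let measurable_affine (c d : R) :
  measurable_fun setT
    ((fun t => c * t + d) : measurableTypeR R -> measurableTypeR R).
Proof. by apply: measurable_funD => //; exact: measurable_funM. Qed.

(** By uniqueness of Lebesgue measure: the pushforward scaled by [c] agrees with [mu] on the
    intervals []a, b]]. *)
Lemma lebesgue_measure_affine (c d : R) (c0 : 0 < c) (A : set R) :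
  measurable A ->
  (c%:E * mu ((fun t => c * t + d)%R @^-1` A) = mu A)%E.
Proof.
move=> mA; apply/esym.
pose nu := measure_function_pushforward__canonical__measure_function_Measure
  mu (measurable_affine c d).
apply: (@lebesgue_measure_unique _ (mscale (NngNum (ltW c0)) nu));
  last exact: mA.
move=> _ [[a b]] _ <-.
change (mu `]a, b] = c%:E * mu ((fun t => (c * t + d)%R) @^-1` `]a, b]))%E.
rewrite (_ : _ @^-1` _ = `](a - d) / c, (b - d) / c]%classic); last first.
  by apply/seteqP; split => x /=; rewrite !in_itv/=;
    rewrite ltr_pdivrMr// ler_pdivlMr// ltrBlDr lerBrDr mulrC.
rewrite !lebesgue_measure_itv/= !lte_fin ltr_pM2r ?invr_gt0// ltrD2r.
case: ifPn => _; last by rewrite mule0.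
by rewrite -!EFinB -EFinM; congr EFin; field; rewrite gt_eqF.
Qed.

(** Nonnegative extended-real integrands allow its use before any integrability is known. *)
Lemma ge0_integral_affine (c d : R) (f : R -> \bar R) : 0 < c ->
  measurable_fun setT f -> (forall x, 0 <= f x)%E ->
  (\int[mu]_x f x = c%:E * \int[mu]_x f (c * x + d)%R)%E.
Proof.
move=> c0 mf f0.
have mg := measurable_affine c d.
have := ge0_integral_pushforward mg mu measurableT mf (fun x _ => f0 x).
rewrite preimage_setT => <-.
rewrite -(ge0_integral_mscale _ measurableT (NngNum (ltW c0)))//.
apply: eq_measure_integral => //= A mA _.
by rewrite -(lebesgue_measure_affine c d c0).
Qed.

End change_of_variables.

(** * The Gamma and Beta integrals *)

Section gamma_beta.
Context {R : realType}.
Local Notation mu := (@lebesgue_measure R).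
Implicit Types (a b c t u x : R).

(** Extended by 0 to the whole line, so that translations and scalings require no tracking of
    domains. *)
Definition gamma_kernel a t : R :=
  if 0 < t then t `^ (a - 1) * expR (- t) else 0.

Definition beta_kernel a b t : R :=
  if (0 < t) && (t < 1) then t `^ (a - 1) * (1 - t) `^ (b - 1) else 0.

(** Kept in the extended reals: Tonelli's theorem then gives the product formula [gammaeM] before
    finiteness is known. *)
Definition gammae a : \bar R := (\int[mu]_t (gamma_kernel a t)%:E)%E.

Definition betae a b : \bar R := (\int[mu]_t (beta_kernel a b t)%:E)%E.

Lemma gamma_kernel_ge0 a t : 0 <= gamma_kernel a t.
Proof.
rewrite /gamma_kernel; case: ifP => // _.
by rewrite mulr_ge0 ?powR_ge0 ?expR_ge0.
Qed.

Lemma beta_kernel_ge0 a b t : 0 <= beta_kernel a b t.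
Proof.
by rewrite /beta_kernel; case: ifP => // _; rewrite mulr_ge0 ?powR_ge0.
Qed.

Lemma measurable_gamma_kernel a : measurable_fun setT (gamma_kernel a).
Proof.
apply: measurable_fun_ifT => //.
- exact: measurable_fun_ltr.
- apply: measurable_funM; first exact: measurable_powR.
  by apply: measurableT_comp => //; exact: measurable_expR.
Qed.

Lemma measurable_beta_kernel a b : measurable_fun setT (beta_kernel a b).
Proof.
apply: measurable_fun_ifT => //.
- by apply: measurable_and; exact: measurable_fun_ltr.
- apply: measurable_funM; first exact: measurable_powR.
  apply: (measurableT_comp (measurable_powR _)).
  exact: measurable_funB.
Qed.

Lemma gammae_ge0 a : (0 <= gammae a)%E.
Proof. by apply: integral_ge0 => t _; rewrite lee_fin gamma_kernel_ge0. Qed.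

Lemma betae_ge0 a b : (0 <= betae a b)%E.
Proof. by apply: integral_ge0 => t _; rewrite lee_fin beta_kernel_ge0. Qed.

(** The integrand of the convolution after the substitution s = u v; the last factor [u] on the left
    is the Jacobian. *)
Lemma gamma_kernel_convolution a b u v : 0 < u ->
  gamma_kernel a (u * v) * gamma_kernel b (u - u * v) * u =
  gamma_kernel (a + b) u * beta_kernel a b v.
Proof.
move=> u0; rewrite /gamma_kernel /beta_kernel u0 pmulr_rgt0//.
rewrite -[X in X - u * v]mulr1 -mulrBr pmulr_rgt0// subr_gt0.
case: ifPn => v0/=; last by rewrite !(mul0r, mulr0).
case: ifPn => v1; last by rewrite !(mul0r, mulr0).
rewrite !powRM ?ltW ?subr_gt0//.
have -> : u `^ (a + b - 1) = u `^ (a - 1) * u `^ (b - 1) * u.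
  rewrite -powRD; last by rewrite (gt_eqF u0) implybT.
  rewrite -[X in _ * X]powRr1 ?ltW// -powRD; last by rewrite (gt_eqF u0) implybT.
  by congr (_ `^ _); lra.
have -> : expR (- u) = expR (- (u * v)) * expR (- (u * (1 - v))).
  by rewrite -expRD; congr expR; lra.
ring.
Qed.

(* Tonelli for the convolution of the two Gamma kernels. *)
Lemma gammaeM a b : (gammae a * gammae b = gammae (a + b) * betae a b)%E.
Proof.
have mg c : measurable_fun [set: R] (EFin \o gamma_kernel c).
  by apply/measurable_EFinP; exact: measurable_gamma_kernel.
have g0 c t : (0 <= (gamma_kernel c t)%:E)%E by rewrite lee_fin gamma_kernel_ge0.
pose f (z : R * R) := (gamma_kernel a z.1 * gamma_kernel b (z.2 - z.1))%:E.
have mf : measurable_fun setT f.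
  apply/measurable_EFinP; apply: measurable_funM.
    exact: (measurableT_comp (measurable_gamma_kernel a) measurable_fst).
  apply: (measurableT_comp (measurable_gamma_kernel b)).
  by apply: measurable_funB; [exact: measurable_snd|exact: measurable_fst].
have f0 z : (0 <= f z)%E by rewrite lee_fin mulr_ge0 ?gamma_kernel_ge0.
transitivity (\int[mu]_s \int[mu]_u f (s, u))%E.
  rewrite /gammae -ge0_integralZr//; last 2 first.
  - exact: mg.
  - exact: gammae_ge0.
  apply: eq_integral => s _.
  (* The translation by [s] makes the sum [u] of the two variables the new inner variable. *)
  rewrite [in LHS](ge0_integral_affine 1 (- s) (EFin \o gamma_kernel b))//; last first.
    by move=> t; exact: g0.
  rewrite mul1e.
  rewrite -[LHS]ge0_integralZl.
  - by apply: eq_integral => u _; rewrite /f/= mul1r EFinM.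
  - exact: measurableT.
  - apply: (measurableT_comp (mg b)).
    by apply: measurable_funD => //; exact: measurable_funM.
  - by move=> t _; exact: g0.
  - exact: g0.
rewrite [LHS](@fubini_tonelli _ _ _ _ _ mu mu f mf f0).
rewrite /gammae -ge0_integralZr//; last 2 first.
- exact: mg.
- exact: betae_ge0.
(* For [u <= 0], the numbers [s] and [u - s] are never both positive, so both sides vanish. *)
apply: eq_integral => u _; have [u0|u0] := ltP 0 u; last first.
  rewrite [gamma_kernel (a + b) u]/gamma_kernel ltNge u0/= mul0e.
  apply: integral0_eq => s _.
  rewrite /f/= /gamma_kernel; case: ifPn => s0; last by rewrite mul0r.
  by rewrite subr_gt0 ltNge (le_trans u0 (ltW s0))/= mulr0.
have mfu : measurable_fun setT (fun s => f (s, u)).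
  by apply: (measurableT_comp mf); exact: measurable_fun_pair.
rewrite [LHS](ge0_integral_affine u 0 (fun s => f (s, u)))//.
rewrite /betae -!ge0_integralZl//.
- apply: eq_integral => v _; rewrite addr0 /f -!EFinM; congr EFin.
  by rewrite mulrC; exact: gamma_kernel_convolution.
- by apply/measurable_EFinP; exact: measurable_beta_kernel.
- by move=> v _; rewrite lee_fin beta_kernel_ge0.
- apply: (measurableT_comp mfu).
  by apply: measurable_funD => //; exact: measurable_funM.
- by rewrite lee_fin ltW.
Qed.

End gamma_beta.

(** * Recurrence, finiteness and positivity of the Gamma integral *)

Section gamma_function.
Context {R : realType}.
Local Notation mu := (@lebesgue_measure R).
Implicit Types (a b c t u x : R).

Lemma continuous_powR a t : 0 < t -> {for t, continuous (powR (R:=R) ^~ a)}.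
Proof.
move=> t0; apply: differentiable_continuous; apply/derivable1_diffP.
by apply: derivable_powR; rewrite in_itv/= t0.
Qed.

(** The fundamental theorem of calculus is applied away from 0, where t^(a-1) may be singular. *)
Lemma integral_powR_itv a b c : 0 < a -> 0 < b -> b < c ->
  (\int[mu]_(t in `[b, c]%classic) (t `^ (a - 1))%:E =
   (a^-1 * c `^ a - a^-1 * b `^ a)%:E)%E.
Proof.
move=> a0 b0 bc; have c0 := lt_trans b0 bc.
have cF t : 0 < t -> {for t, continuous (fun t : R => a^-1 * t `^ a)}.
  by move=> t0; apply: cvgM; [exact: cvg_cst|exact: continuous_powR].
rewrite (@continuous_FTC2 _ _ (fun t => a^-1 * t `^ a))//.
- apply: continuous_in_subspaceT => t; rewrite inE/= in_itv/= => /andP[bt _].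
  by apply: continuous_powR; rewrite (lt_le_trans b0).
- split.
  + move=> t; rewrite in_itv/= => /andP[bt _].
    apply: derivableM => //; apply: derivable_powR.
    by rewrite in_itv/= (lt_trans b0 bt).
  + by apply: cvg_at_right_filter; exact: cF.
  + by apply: cvg_at_left_filter; exact: cF.
- move=> t; rewrite in_itv/= => /andP[bt _].
  have t0 : t \in `]0, +oo[%R by rewrite in_itv/= (lt_trans b0 bt).
  rewrite derive1Ml; last exact: derivable_powR.
  by rewrite powR_derive1// mulrA mulVf ?mul1r ?gt_eqF.
Qed.

(** Monotone convergence along the intervals [[e n, 1]], which exhaust []0, 1]]. *)
Lemma integral_powR01 a : 0 < a ->
  (\int[mu]_(t in `]0%R, 1%R]%classic) (t `^ (a - 1))%:E = (a^-1)%:E)%E.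
Proof.
move=> a0.
(* The shift by 2 keeps [e n] strictly below 1, as [integral_powR_itv] requires. *)
pose e (n : nat) : R := n.+2%:R^-1.
have e0 n : 0 < e n by rewrite invr_gt0.
have e1 n : e n < 1 by rewrite invf_lt1// ltr1n.
have ne n m : (n <= m)%N -> e m <= e n.
  by move=> nm; rewrite lef_pV2 ?posrE// ler_nat ltnS.
have cve : e @ \oo --> 0.
  by have := @cvg_harmonic R; rewrite -cvg_shiftS.
pose F n : set R := `[e n, 1]%classic.
have -> : `]0, 1]%classic = \bigcup_n F n.
  apply/seteqP; split => [x|x [n _]]; rewrite /F/= !in_itv/=; last first.
    by move=> /andP[nx ->]; rewrite (lt_le_trans (e0 n) nx).
  move=> /andP[x0 x1].
  have /cvgrPdist_lt/(_ _ x0)[N _ /(_ _ (leqnn N))] := cve.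
  rewrite sub0r normrN gtr0_norm// => /ltW eN.
  by exists N => //=; rewrite in_itv/= eN.
have mp : measurable_fun setT (fun t : R => (t `^ (a - 1))%:E).
  by apply/measurable_EFinP; exact: measurable_powR.
transitivity (limn (fun n => \int[mu]_(t in F n) (t `^ (a - 1))%:E)%E).
  apply/esym/cvg_lim => //; apply: ge0_nondecreasing_set_cvg_integral.
  - move=> n m nm; rewrite subsetEset => x; rewrite /F/= !in_itv/=.
    by move=> /andP[nx ->]; rewrite (le_trans (ne _ _ nm) nx).
  - by move=> n; exact: measurable_itv.
  - by move=> n; exact: measurable_funTS.
  - by move=> n t _; rewrite lee_fin powR_ge0.
apply/cvg_lim => //.
rewrite (_ : (fun n => _) = EFin \o (fun n => a^-1 - a^-1 * e n `^ a)).
  apply: cvg_EFin; first by near=> n.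
  rewrite -[X in _ --> X]subr0; apply: cvgB; first exact: cvg_cst.
  rewrite -[X in _ --> X](mulr0 a^-1); apply: cvgM; first exact: cvg_cst.
  by have /cvg_at_rightP := powR_cvg0 a0; apply.
by apply/funext => n; rewrite integral_powR_itv// powR1 mulr1.
Unshelve. all: by end_near. Qed.

Lemma betae1 a : 0 < a -> betae a 1 = (a^-1)%:E.
Proof.
move=> a0; rewrite -integral_powR01// -[RHS]integral_itv_bndo_bndc; last first.
  by apply: measurable_funTS; apply/measurable_EFinP; exact: measurable_powR.
rewrite [RHS]integral_mkcond; apply: eq_integral => t _.
rewrite patchE /beta_kernel; case: ifPn => [t01|t01]; last first.
  by rewrite memNset//= in_itv/=; exact/negP.
by rewrite mem_set//= ?in_itv// subrr powRr0 mulr1.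
Qed.

(** The integrand is the density of the exponential law of rate 1. *)
Lemma gammae1 : gammae (1 : R) = 1%E.
Proof.
rewrite -(integral_exponential_pdf (@ltr01 R)).
transitivity (\int[mu]_(t in `]0%R, +oo[%classic) (expR (- t))%:E)%E.
  rewrite [RHS]integral_mkcond; apply: eq_integral => t _.
  rewrite patchE /gamma_kernel; case: ifPn => [t0|t0]; last first.
    by rewrite memNset//= in_itv/= andbT; exact/negP.
  by rewrite mem_set//= ?in_itv/= ?andbT// subrr powRr0 mul1r.
rewrite integral_itv_obnd_cbnd; last first.
  by apply: measurable_funTS; apply/measurable_EFinP;
    apply: measurableT_comp => //; exact: measurable_expR.
rewrite [LHS]integral_mkcond; apply: eq_integral => t _.
rewrite /exponential_pdf !patchE; case: ifPn => // _.
by rewrite mulN1r mul1r.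
Qed.

(* [gammaeM] at b = 1: B(a, 1) = 1 / a. *)
Lemma gammae_succ a : 0 < a -> gammae a = (gammae (a + 1) * (a^-1)%:E)%E.
Proof. by move=> a0; rewrite -betae1// -gammaeM gammae1 mule1. Qed.

(** The recurrence gives finiteness at the positive integers. For real [a], choose an integer n >=
    a: then t^a <= 1 + t^n bounds the integral at [a + 1], and the recurrence leads back to [a]. *)
Lemma gammae_fin_num a : 0 < a -> gammae a \is a fin_num.
Proof.
move=> a0.
have mg b : measurable_fun [set: R] (EFin \o gamma_kernel b).
  by apply/measurable_EFinP; exact: measurable_gamma_kernel.
have g0 b t : (0 <= (gamma_kernel b t)%:E)%E by rewrite lee_fin gamma_kernel_ge0.
have fin_nat n : gammae (n%:R + 1 : R) \is a fin_num.
  elim: n => [|n IH]; first by rewrite add0r gammae1.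
  have n0 : (0 : R) < n%:R + 1 by rewrite natr1 ltr0n.
  (* The recurrence is read backwards: an infinite value at n + 2 would make the value at n + 1
     infinite. *)
  move: IH; rewrite (gammae_succ _ n0) -natr1.
  have := gammae_ge0 (n%:R + 1 + 1 : R).
  by case: (gammae (n%:R + 1 + 1)) => //= _; rewrite mulyr gtr0_sg ?invr_gt0// mul1e.
rewrite (gammae_succ _ a0) fin_numM//.
have [n an] : exists n : nat, a <= n%:R.
  by exists (Num.truncn a).+1; rewrite ltW// truncnS_gt.
rewrite ge0_fin_numE ?gammae_ge0//.
apply: (@le_lt_trans _ _ (gammae 1 + gammae (n%:R + 1 : R))%E); last first.
  by apply: lte_add_pinfty; rewrite -ge0_fin_numE ?gammae_ge0// gammae1.
rewrite /gammae -ge0_integralD//; [|exact: mg|exact: mg].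
apply: ge0_le_integral => //.
- exact: mg.
- by apply: emeasurable_funD; exact: mg.
- move=> t _; rewrite -EFinD lee_fin /gamma_kernel; case: ifPn => t0;
    last by rewrite addr0.
  rewrite -mulrDl ler_wpM2r ?expR_ge0// !addrK subrr powRr0.
  have [t1|t1] := leP t 1.
    rewrite (@le_trans _ _ 1) ?lerDl ?powR_ge0//.
    by rewrite -(powRr0 t) ger_powR ?t0 ?t1 ?ltW.
  by rewrite (le_trans (ler_powR (ltW t1) an))// lerDr.
Qed.

(** By the recurrence it suffices to treat [a + 1]. Translating by 1 and using 1 <= t^a for t > 1
    gives 1 = [gammae 1] <= e [gammae (a + 1)], so the latter is not 0. *)
Lemma gammae_gt0 a : 0 < a -> (0 < gammae a)%E.
Proof.
move=> a0; have mg b : measurable_fun [set: R] (EFin \o gamma_kernel b).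
  by apply/measurable_EFinP; exact: measurable_gamma_kernel.
have g0 b t : (0 <= (gamma_kernel b t)%:E)%E by rewrite lee_fin gamma_kernel_ge0.
rewrite (gammae_succ _ a0) mule_gt0 ?lte_fin ?invr_gt0//.
rewrite lt0e gammae_ge0 andbT; apply/eqP => ga0.
have : (gammae 1 <= (expR 1)%:E * gammae (a + 1))%E.
  rewrite [leLHS](ge0_integral_affine 1 (- 1) (EFin \o gamma_kernel 1))//; last first.
    by move=> t; exact: g0.
  rewrite mul1e -[leRHS]ge0_integralZl//.
  - apply: ge0_le_integral => //.
    + by move=> t _; exact: g0.
    + apply: (measurableT_comp (mg 1)).
      by apply: measurable_funD => //; exact: measurable_funM.
    + by apply: measurable_funeM; exact: mg.
    + move=> t _; rewrite -EFinM lee_fin /= /gamma_kernel mul1r subr_gt0 addrK.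
      case: ifPn => t1; last first.
        by case: ifPn => // t0; rewrite !mulr_ge0 ?powR_ge0 ?expR_ge0.
      rewrite (lt_trans ltr01 t1) subrr powRr0 mul1r opprB expRD mulrCA.
      by rewrite ler_peMl ?mulr_ge0 ?expR_ge0// -(powRr0 t) ler_powR ?ltW.
  - exact: mg.
by rewrite ga0 mule0 gammae1 lee_fin ler10.
Qed.

End gamma_function.

(** * Moments of the Laguerre and Jacobi weights *)

Section moments.
Context {R : realType}.
Local Notation mu := (@lebesgue_measure R).
Implicit Types (a b t x : R).

(** One computation of an extended integral yields both integrability and the real value of a
    moment. *)
Lemma ge0_Rintegral (D : set R) (f : R -> R) (r : R) : measurable D ->
  measurable_fun D f -> (forall x, D x -> 0 <= f x) ->
  (\int[mu]_(x in D) (f x)%:E = r%:E)%E ->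
  mu.-integrable D (EFin \o f) /\ \int[mu]_(x in D) f x = r.
Proof.
move=> mD mf f0 fr; split; last by rewrite /Rintegral fr.
apply/integrableP; split; first exact/measurable_EFinP.
rewrite [ltLHS](_ : _ = r%:E) ?ltry// -fr; apply: eq_integral => x.
by rewrite inE => Dx; rewrite /= ger0_norm ?f0.
Qed.

Lemma Rintegral_lincomb (D : set R) (I : Type) (s : seq I) (c : I -> R)
    (f : I -> R -> R) : measurable D ->
  (forall i : I, mu.-integrable D (EFin \o f i)) ->
  mu.-integrable D (EFin \o (fun x => \sum_(i <- s) c i * f i x)) /\
  \int[mu]_(x in D) (\sum_(i <- s) c i * f i x) =
  \sum_(i <- s) c i * \int[mu]_(x in D) f i x.
Proof.
move=> mD intf; elim: s => [|i s [IHi IH]].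
  split; last first.
    rewrite big_nil; under eq_Rintegral do rewrite big_nil.
    by rewrite Rintegral_cst// mul0r.
  by under eq_fun do rewrite big_nil; exact: integrable0.
have intif : mu.-integrable D (EFin \o (fun x => c i * f i x)).
  rewrite (_ : _ \o _ = (fun x => (c i)%:E * (EFin \o f i) x)%E)//.
  exact: integrableZl.
split.
  rewrite (_ : _ \o _ = (fun x => (c i * f i x)%:E +
      (\sum_(i <- s) c i * f i x)%:E)%E); last first.
    by apply/funext => x /=; rewrite big_cons EFinD.
  exact: integrableD.
under eq_Rintegral do rewrite big_cons.
by rewrite RintegralD// RintegralZl// IH big_cons.
Qed.

Lemma fine_gammae a : Gamma a = fine (gammae a).
Proof.
rewrite /Gamma /Rintegral /gammae; congr fine.
rewrite -integral_itv_obnd_cbnd; last first.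
  apply: measurable_funTS; apply/measurable_EFinP; apply: measurable_funM.
    exact: measurable_powR.
  by apply: measurableT_comp => //; exact: measurable_expR.
rewrite [LHS]integral_mkcond; apply: eq_integral => t _.
rewrite patchE /gamma_kernel; case: ifPn => [|/negP].
  by rewrite inE/= in_itv/= andbT => ->.
by rewrite inE/= in_itv/= andbT => /negP/negPf ->.
Qed.

Lemma gammaeE a : 0 < a -> gammae a = (Gamma a)%:E.
Proof. by move=> a0; rewrite fine_gammae fineK// gammae_fin_num. Qed.

Lemma Gamma_gt0 a : 0 < a -> 0 < Gamma a.
Proof. by move=> a0; rewrite -lte_fin -gammaeE// gammae_gt0. Qed.

Lemma GammaD1 a : 0 < a -> Gamma (a + 1) = a * Gamma a.
Proof.
move=> a0; have := gammae_succ _ a0; rewrite !gammaeE ?addr_gt0// -EFinM => -[->].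
by rewrite mulrCA divff ?mulr1 ?gt_eqF.
Qed.

Lemma pochhammerS x n : pochhammer x n.+1 = pochhammer x n * (x + n%:R).
Proof. by rewrite /pochhammer big_nat_recr. Qed.

Lemma Gamma_pochhammer a n : 0 < a -> Gamma (a + n%:R) = Gamma a * pochhammer a n.
Proof.
move=> a0; elim: n => [|n IH].
  by rewrite addr0 /pochhammer big_geq// mulr1.
by rewrite -natr1 addrA GammaD1 ?ltr_pwDl// IH pochhammerS mulrC mulrA.
Qed.

Lemma betaeE a b : 0 < a -> 0 < b ->
  betae a b = (Gamma a * Gamma b / Gamma (a + b))%:E.
Proof.
move=> a0 b0; have ab0 := addr_gt0 a0 b0.
have g0 := Gamma_gt0 _ ab0; have := gammaeM a b; rewrite !gammaeE// -EFinM.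
(* An infinite Beta integral would contradict the finiteness of the product of the two Gamma
   values. *)
have := betae_ge0 a b; case: (betae a b) => [r _|_|//]; last first.
  by rewrite gt0_muley ?lte_fin.
by rewrite -EFinM => -[->]; rewrite mulrAC divff ?mul1r ?gt_eqF.
Qed.

Lemma exprM_powR x a m : 0 < x -> x ^+ m * x `^ a = x `^ (a + m%:R).
Proof.
by move=> x0; rewrite -powR_mulrn ?ltW// mulrC powRD// (gt_eqF x0) implybT.
Qed.

Lemma laguerre_moment a m : -1 < a ->
  let f x := x ^+ m * (expR (- x) * x `^ a) in
  mu.-integrable `[0, +oo[ (EFin \o f) /\
  \int[mu]_(x in `[0, +oo[) f x = Gamma (a + 1 + m%:R).
Proof.
move=> a1 f; have am0 : 0 < a + 1 + m%:R by rewrite ltr_wpDr//; lra.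
have mf : measurable_fun setT f.
  apply: measurable_funM; first exact: measurable_funX.
  apply: measurable_funM; last exact: measurable_powR.
  by apply: measurableT_comp => //; exact: measurable_expR.
apply: ge0_Rintegral => //.
- exact: measurable_funTS.
- move=> x; rewrite /= in_itv/= andbT => x0.
  by rewrite !mulr_ge0 ?exprn_ge0 ?expR_ge0 ?powR_ge0.
(* The endpoint 0 is removed because x^m x^a is merged into a single power for x > 0 only. *)
rewrite -gammaeE// -integral_itv_obnd_cbnd; last first.
  by apply: measurable_funTS; exact/measurable_EFinP.
rewrite [LHS]integral_mkcond; apply: eq_integral => t _.
rewrite patchE /gamma_kernel; case: ifPn => [|/negP].
  rewrite inE/= in_itv/= andbT => t0; rewrite t0 /f mulrCA exprM_powR// mulrC.
  by congr (_ `^ _ * _)%:E; lra.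
by rewrite inE/= in_itv/= andbT => /negP/negPf ->.
Qed.

Lemma jacobi_moment a b m : -1 < a -> -1 < b ->
  let f x := x ^+ m * (x `^ a * (1 - x) `^ b) in
  mu.-integrable `[0, 1] (EFin \o f) /\
  \int[mu]_(x in `[0, 1]) f x =
    Gamma (a + 1 + m%:R) * Gamma (b + 1) / Gamma (a + 1 + m%:R + (b + 1)).
Proof.
move=> a1 b1 f; have am0 : 0 < a + 1 + m%:R by rewrite ltr_wpDr//; lra.
have b0 : 0 < b + 1 by lra.
have mf : measurable_fun setT f.
  apply: measurable_funM; first exact: measurable_funX.
  apply: measurable_funM; first exact: measurable_powR.
  by apply: (measurableT_comp (measurable_powR _)); exact: measurable_funB.
apply: ge0_Rintegral => //.
- exact: measurable_funTS.
- move=> x; rewrite /= in_itv/= => /andP[x0 _].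
  by rewrite !mulr_ge0 ?exprn_ge0 ?powR_ge0.
rewrite -betaeE// integral_itv_bndoo; last first.
  by apply: measurable_funTS; exact/measurable_EFinP.
rewrite [LHS]integral_mkcond; apply: eq_integral => t _.
rewrite patchE /beta_kernel; case: ifPn => [|/negP].
  rewrite inE/= in_itv/= => /[dup] t01 /andP[t0 t1].
  rewrite t01 /f mulrA exprM_powR//.
  by congr (_ `^ _ * _ `^ _)%:E; lra.
by rewrite inE/= in_itv/= => /negP/negPf ->.
Qed.

End moments.

(** * Interpolation and divided differences *)

Section interpolation.
Context {F : fieldType} {T : finType} (y : T -> F).
Hypothesis y_inj : injective y.
Implicit Types (g : {poly F}) (t s : T) (w : F).

(** Unnormalised Lagrange basis: [ell t] vanishes at every node other than [y t], where its value is
    [omega t]. *)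
Let ell t : {poly F} := \prod_(s | s != t) ('X - (y s)%:P).
Let omega t : F := \prod_(s | s != t) (y t - y s).

Let omega_neq0 t : omega t != 0.
Proof.
by apply/prodf_neq0 => s st; rewrite subr_eq0 (inj_eq y_inj) eq_sym.
Qed.

Let horner_ell t w : (ell t).[w] = \prod_(s | s != t) (w - y s).
Proof. by rewrite horner_prod; apply: eq_bigr => s _; rewrite hornerXsubC. Qed.

Let size_ell t : size (ell t) = #|T|.
Proof.
rewrite /ell -big_filter size_prod_XsubC size_filter.
have := cardC1 t; rewrite cardE size_filter => ->.
by rewrite prednK//; apply/card_gt0P; exists t.
Qed.

(** The difference of the two sides has degree below #|T| and vanishes at #|T| distinct nodes. *)
Lemma lagrange_interpolation g : (size g <= #|T|)%N ->
  g = \sum_t (g.[y t] / omega t) *: ell t.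
Proof.
move=> sg; apply/eqP; rewrite -subr_eq0; apply/eqP.
apply: (@roots_geq_poly_eq0 _ _ (map y (enum T))).
- apply/allP => _ /mapP[t _ ->]; rewrite rootE hornerD hornerN horner_sum.
  rewrite (bigD1 t)//= hornerZ horner_ell divfK// big1 ?addr0 ?subrr// => s st.
  rewrite hornerZ horner_ell (bigD1 t) 1?eq_sym//= subrr mul0r mulr0 //.
- by rewrite map_inj_uniq ?enum_uniq.
- rewrite size_map -cardE (leq_trans (size_polyD _ _))// geq_max sg size_polyN.
  apply: (leq_trans (size_sum _ _ _)); apply/bigmax_leqP => t _.
  by rewrite (leq_trans (size_scale_leq _ _))// size_ell.
Qed.

(** The left side is the divided difference of [g]. Compare the leading coefficients in the
    interpolation formula, each [ell t] being monic of degree #|T| - 1. *)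
Lemma sum_div_prod_nodes g : (size g <= #|T|)%N ->
  \sum_t g.[y t] / (\prod_(s | s != t) (y t - y s)) = g`_(#|T|.-1).
Proof.
move=> sg; rewrite {2}(lagrange_interpolation _ sg) coef_sum.
apply: eq_bigr => t _; rewrite coefZ -(size_ell t) -lead_coefE.
have /eqP -> : ell t \is monic.
  by rewrite /ell -big_filter monic_prod_XsubC.
by rewrite mulr1.
Qed.

(* Obtained by evaluating the interpolation formula at w. *)
Lemma sum_div_prod_nodes_pole g w : (size g <= #|T|)%N ->
  (forall t, w != y t) ->
  \sum_t g.[y t] / ((y t - w) * \prod_(s | s != t) (y t - y s)) =
  - (g.[w] / \prod_t (w - y t)).
Proof.
move=> sg wy; rewrite {2}(lagrange_interpolation _ sg) horner_sum mulr_suml.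
rewrite -sumrN; apply: eq_bigr => t _.
have wt s : w - y s != 0 by rewrite subr_eq0.
rewrite hornerZ horner_ell -/(omega t) [\prod_t0 _](bigD1 t)//=.
set P := \prod_(s | s != t) (w - y s).
have P0 : P != 0 by apply/prodf_neq0 => s _.
by rewrite -(opprB w); field; rewrite P0 omega_neq0 oppr_eq0 wt.
Qed.

(** The auxiliary points [z] make the family [q] triangular, hence linearly independent; its matrix
    of values at the distinct nodes is then invertible. *)
Lemma dual_basis_unique (q : nat -> {poly F}) (z : nat -> F) (d : T -> F) :
  (forall j, (j < #|T|)%N -> (size (q j) <= #|T|)%N) ->
  (forall j m, (m < j < #|T|)%N -> (q j).[z m] = 0) ->
  (forall j, (j < #|T|)%N -> (q j).[z j] != 0) ->
  (forall j, (j < #|T|)%N -> \sum_t d t * (q j).[y t] = 0) ->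
  forall t, d t = 0.
Proof.
move=> sq q0 qN0 dq0 t.
pose M : 'M[F]_#|T| := \matrix_(j, k) (q j).[y (enum_val k)].
have Mu : M \in unitmx.
  (* A vector in the left kernel gives a combination of the [q j] that vanishes at all nodes, hence
     is the zero polynomial. *)
  rewrite -row_free_unit; apply: inj_row_free => u uM0.
  pose f := \sum_(j < #|T|) u 0 j *: q j.
  have f0 : f = 0.
    apply: (@roots_geq_poly_eq0 _ _ (map y (enum T))).
    - apply/allP => _ /mapP[s _ ->]; rewrite rootE horner_sum.
      have /matrixP/(_ 0 (enum_rank s)) := uM0; rewrite !mxE => /eqP.
      congr (_ == _); apply: eq_bigr => j _.
      by rewrite mxE enum_rankK hornerZ.
    - by rewrite map_inj_uniq ?enum_uniq.
    - rewrite size_map -cardE; apply: (leq_trans (size_sum _ _ _)).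
      apply/bigmax_leqP => j _.
      by rewrite (leq_trans (size_scale_leq _ _))// sq.
  suff u0 m (hm : (m < #|T|)%N) : u 0 (Ordinal hm) = 0.
    by apply/rowP => -[m hm]; rewrite u0 mxE.
  (* Strong induction on [m]: at [z m] the terms with j > m vanish by triangularity, those with j <
     m by induction. *)
  have [k] := ubnP m; elim: k m hm => // k IH m hm /ltnSE mk.
  have := congr1 (horner^~ (z m)) f0; rewrite horner0 horner_sum.
  rewrite (bigD1 (Ordinal hm))//= big1 ?addr0; last first.
    move=> [j hj]; rewrite -val_eqE/= hornerZ neq_ltn => /orP[jm|mj].
      by rewrite IH ?mul0r// (leq_trans jm).
    by rewrite q0 ?mulr0// mj.
  by rewrite hornerZ => /eqP; rewrite mulf_eq0 (negPf (qN0 _ hm)) orbF => /eqP.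
pose v : 'cV[F]_#|T| := \col_k d (enum_val k).
have : M *m v = 0.
  apply/colP => j; rewrite !mxE -[RHS](dq0 j (ltn_ord j)).
  rewrite [RHS](reindex (@enum_val T T)); last first.
    by apply: onW_bij; exact: enum_val_bij.
  by apply: eq_bigr => k _; rewrite !mxE mulrC.
move=> /(congr1 (mulmx (invmx M))); rewrite mulKmx// mulmx0.
by move=> /colP/(_ (enum_rank t)); rewrite !mxE enum_rankK.
Qed.

End interpolation.

(** * Pochhammer symbols *)

Section pochhammer_theory.
Context {R : realType}.
Implicit Types (a b c v x : R) (m n l : nat).

Lemma pochhammer0 x : pochhammer x 0 = 1.
Proof. by rewrite /pochhammer big_geq. Qed.

Lemma pochhammer_neq0 x n :
  (forall m, (m < n)%N -> x + m%:R != 0) -> pochhammer x n != 0.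
Proof.
elim: n => [|n IH] xn; first by rewrite pochhammer0 oner_neq0.
rewrite pochhammerS mulf_neq0 ?xn//.
by apply: IH => m mn; rewrite xn// ltnW.
Qed.

Lemma pochhammer_gt0 x n : 0 < x -> 0 < pochhammer x n.
Proof.
move=> x0; elim: n => [|n IH]; first by rewrite pochhammer0.
by rewrite pochhammerS mulr_gt0// ltr_wpDr.
Qed.

Lemma pochhammer_oppn m n : (m < n)%N -> pochhammer (- m%:R : R) n = 0.
Proof.
elim: n => // n IH; rewrite ltnS leq_eqVlt pochhammerS => /predU1P[<-|mn].
  by rewrite addNr mulr0.
by rewrite IH// mul0r.
Qed.

(** The polynomial (X + c)_n, written through its roots to make its degree and monicity
    immediate. *)
Definition poly_pochhammer c n : {poly R} :=
  \prod_(0 <= m < n) ('X - (- (c + m%:R))%:P).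

Lemma horner_poly_pochhammer c n x : (poly_pochhammer c n).[x] = pochhammer (x + c) n.
Proof.
rewrite horner_prod; apply: eq_bigr => m _.
by rewrite hornerXsubC opprK addrA.
Qed.

Lemma size_poly_pochhammer c n : size (poly_pochhammer c n) = n.+1.
Proof. by rewrite size_prod_XsubC size_iota subn0. Qed.

Lemma prod_subn l : \prod_(0 <= m < l) (l%:R - m%:R) = l`!%:R :> R.
Proof.
elim: l => [|l IH]; first by rewrite big_geq.
rewrite big_nat_recl// subr0 factS natrM -IH; congr (_ * _).
by apply: eq_bigr => m _; rewrite -!natr1; ring.
Qed.

(** The factors with m < l contribute l!, the [k] factors with m > l contribute (-1)^k k!. *)
Lemma prod_subn_neq l k :
  \prod_(0 <= m < l.+1 + k | m != l) (l%:R - m%:R) =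
  (-1) ^+ k * l`!%:R * k`!%:R :> R.
Proof.
elim: k => [|k IH].
  rewrite addn0 big_mkcond big_nat_recr//= eqxx mulr1 expr0 mul1r fact0 mulr1.
  rewrite -prod_subn big_seq_cond [RHS]big_seq_cond; apply: eq_bigr => m.
  by rewrite mem_index_iota andbT => /andP[_ ml]; rewrite neq_ltn ml.
rewrite addnS big_mkcond big_nat_recr//= -big_mkcond IH.
have -> : ((l.+1 + k)%N != l) by rewrite neq_ltn addSn ltnS leq_addr orbT.
rewrite factS natrM exprS natrD -!natr1; ring.
Qed.

(** Converts the upper parameter -n_i + 1 of the series into factorials, with l + k = n_i - 1. *)
Lemma pochhammer_fact k l :
  pochhammer (- (l + k)%:R) l * k`!%:R = (-1) ^+ l * (l + k)`!%:R :> R.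
Proof.
elim: l k => [|l IH] k; first by rewrite pochhammer0.
rewrite pochhammerS addSnnS.
have -> : - (l + k.+1)%:R + l%:R = - k.+1%:R :> R by rewrite natrD; ring.
transitivity (- (pochhammer (- (l + k.+1)%:R) l * k.+1`!%:R : R)).
  by rewrite factS natrM; ring.
by rewrite IH exprS; ring.
Qed.

(** Both sides are the product of v + 1 - m over 0 <= m <= n. *)
Lemma prod_sub_shift v n :
  (v + 1 - n%:R) * \prod_(0 <= m < n) (v + 1 - m%:R) =
  (v + 1) * \prod_(0 <= m < n) (v - m%:R).
Proof.
elim: n => [|n IH]; first by rewrite !big_geq// subr0.
rewrite !big_nat_recr//= [LHS]mulrCA (mulrA _ _ (v - _)) -IH -natr1; ring.
Qed.

(** By [prod_sub_shift], raising [l] by one multiplies the product by (1 - x + l) / (1 - x - n + l);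
    these ratios build up the quotient of Pochhammer symbols. *)
Lemma prod_sub_pochhammer x n l : (forall m, 1 - x - n%:R + m%:R != 0) ->
  \prod_(0 <= m < n) (l%:R - x - m%:R) =
  (-1) ^+ n * pochhammer x n * (pochhammer (1 - x) l / pochhammer (1 - x - n%:R) l).
Proof.
move=> xn; elim: l => [|l IH].
  rewrite !pochhammer0 divr1 mulr1 /pochhammer.
  elim: n {xn} => [|n IH]; first by rewrite !big_geq// mulr1.
  by rewrite !big_nat_recr//= IH exprS; ring.
have xl : 1 - x - n%:R + l%:R != 0 by exact: xn.
have P0 : pochhammer (1 - x - n%:R) l != 0 by apply: pochhammer_neq0 => m _.
have := prod_sub_shift (l%:R - x) n; rewrite IH.
rewrite (_ : l%:R - x + 1 - n%:R = 1 - x - n%:R + l%:R); last by ring.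
move=> /(canRL (mulKf xl)).
rewrite (eq_bigr (fun m => l.+1%:R - x - m%:R)) => [|m _]; last first.
  by rewrite -natr1; ring.
move=> ->; rewrite !pochhammerS; field.
by rewrite P0 xl.
Qed.

Lemma cvg_pochhammer_div c l :
  pochhammer (c + x) l / x ^+ l @[x --> +oo] --> (1 : R).
Proof.
elim: l => [|l IH].
  under eq_fun do rewrite pochhammer0 expr0 divr1.
  exact: cvg_cst.
have cV : x^-1 @[x --> +oo] --> (0 : R).
  by apply/gtr0_cvgV0; [exact: nbhs_pinfty_gt|exact: cvg_id].
have c1 : 1 + (c + l%:R) * x^-1 @[x --> +oo] --> (1 : R).
  rewrite -[X in _ --> X]addr0 -(mulr0 (c + l%:R)).
  by apply: cvgD; [exact: cvg_cst|apply: cvgM => //; exact: cvg_cst].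
rewrite -[X in _ --> X]mulr1; apply: cvg_trans (cvgM IH c1).
apply: near_eq_cvg; near=> x.
have b0 : 0 < x by near: x; exact: nbhs_pinfty_gt.
rewrite /= pochhammerS exprSr. field.
by rewrite expf_neq0 gt_eqF.
Unshelve. all: by end_near. Qed.

End pochhammer_theory.

(** * Coefficients as divided differences *)

Section nodes.
Context {R : realType} {p : nat}.
Variables (alpha : 'I_p -> R) (n : 'I_p -> nat).
Hypothesis alpha_gtN1 : forall i, -1 < alpha i.
Hypothesis alpha_diff : forall i j, i != j -> alpha i - alpha j \isn't a Num.int.
Implicit Types (i k : 'I_p) (l m j : nat) (beta : R).

Local Notation N := (multi_size n).

Definition node : finType := {i : 'I_p & 'I_(n i)}.

Implicit Types (s t : node).

Definition node_value t : R := alpha (tag t) + (tagged t)%:R.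

Lemma alpha_diff_neq i k (z : int) : i != k -> alpha i - alpha k != z%:~R.
Proof. by move=> /alpha_diff; apply: contraNneq => ->; exact: intr_int. Qed.

(** Equal values at (i, l) and (k, m) with i != k would make alpha_i - alpha_k the integer m - l. *)
Lemma node_value_inj : injective node_value.
Proof.
move=> [i l] [k m]; rewrite /node_value/= => ykm.
have [ik|ik] := eqVneq i k; last first.
  have /eqP[] := alpha_diff_neq i k (m%:Z - l%:Z) ik.
  by rewrite intrB/=; move: ykm; rewrite -!pmulrn; lra.
subst k; congr Tagged; apply/val_inj => /=.
by move: ykm => /addrI/eqP; rewrite eqr_nat => /eqP.
Qed.

Lemma card_node : #|{: node}| = N.
Proof.
rewrite card_tagged sumnE big_map big_enum /=.
by apply: eq_bigr => i _; rewrite card_ord.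
Qed.

Lemma node_value1_gt0 t : 0 < node_value t + 1.
Proof.
have := alpha_gtN1 (tag t); have := ler0n R (tagged t).
by rewrite /node_value; lra.
Qed.

Lemma sum_node (f : 'I_p -> nat -> R) :
  \sum_i \sum_(l < n i) f i l = \sum_(t : node) f (tag t) (tagged t).
Proof. exact: sig_big_dep. Qed.

Lemma prod_node (f : 'I_p -> nat -> R) (P : 'I_p -> pred nat) :
  \prod_i \prod_(l < n i | P i l) f i l =
  \prod_(t : node | P (tag t) (tagged t)) f (tag t) (tagged t).
Proof. exact: sig_big_dep. Qed.

(** Excluding by value rather than by node lets [l] be an arbitrary natural number; [omegaE]
    recovers the product over the other nodes. *)
Definition omega i l : R :=
  \prod_(t : node | node_value t != alpha i + l%:R)
    (alpha i + l%:R - node_value t).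

Lemma omegaE t : omega (tag t) (tagged t) =
  \prod_(s | s != t) (node_value t - node_value s).
Proof. by apply: eq_bigl => s; rewrite -/(node_value t) (inj_eq node_value_inj). Qed.

Lemma omega_neq0 i l : omega i l != 0.
Proof. by apply/prodf_neq0 => t; rewrite subr_eq0 eq_sym. Qed.

Definition laguerre_coef i l : R := (Gamma (alpha i + l%:R + 1) * omega i l)^-1.

(* The condition on [q] says that (q j (- (1 + m)))_(j, m) is triangular with
   nonzero diagonal, so that the q_j span the polynomials of degree < N. *)
Lemma moment_coef_unique (mom : node -> nat -> R) (kappa : node -> R)
    (q : nat -> {poly R}) (c c' : node -> R) :
  (forall j, (j < N)%N -> (size (q j) <= N)%N) ->
  (forall j m, (m < j < N)%N -> (q j).[- (1 + m%:R)] = 0) ->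
  (forall j, (j < N)%N -> (q j).[- (1 + j%:R)] != 0) ->
  (forall t, kappa t != 0) ->
  (forall t j, (j < N)%N -> mom t j = kappa t * (q j).[node_value t]) ->
  (forall j, (j < N)%N -> \sum_(t : node) c t * mom t j = \sum_t c' t * mom t j) ->
  c =1 c'.
Proof.
move=> sq q0 qN0 kN0 momE cc' t; apply/eqP; rewrite -subr_eq0.
rewrite -(inj_eq (mulIf (kN0 t))) mul0r; apply/eqP.
pose d t := (c t - c' t) * kappa t.
apply: (dual_basis_unique _ node_value_inj q (fun m => - (1 + m%:R)) d);
  rewrite card_node// => j jN.
transitivity (\sum_(t : node) (c t * mom t j - c' t * mom t j)).
  by apply: eq_bigr => s _; rewrite -mulrBl momE// mulrA.
by rewrite sumrB cc'// subrr.
Qed.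

Lemma laguerre_coef_sum j : (j < N)%N ->
  \sum_(t : node) laguerre_coef (tag t) (tagged t) *
    Gamma (alpha (tag t) + 1 + (j + tagged t)%:R) =
  if j == N.-1 then 1 else 0.
Proof.
move=> jN; have N0 : (0 < N)%N by case: N jN.
transitivity (\sum_(t : node) (poly_pochhammer 1 j : {poly R}).[node_value t] /
    \prod_(s | s != t) (node_value t - node_value s)).
  apply: eq_bigr => t _; rewrite /laguerre_coef omegaE -/(node_value t).
  rewrite horner_poly_pochhammer.
  rewrite (_ : _ + 1 + _ = node_value t + 1 + j%:R); last first.
    by rewrite /node_value natrD; ring.
  rewrite Gamma_pochhammer ?node_value1_gt0// invfM mulrCA !mulrA mulfV ?mul1r//.
    by rewrite mulrC.
  by rewrite gt_eqF// Gamma_gt0// node_value1_gt0.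
rewrite sum_div_prod_nodes; last 2 first.
  exact: node_value_inj.
  by rewrite size_poly_pochhammer card_node.
(* (X + 1)_j is monic of degree j, so its coefficient at X^(N-1) is 1 for j = N - 1 and 0 for
   smaller j. *)
rewrite card_node; case: eqP => [->|/eqP jN1].
  have /monicP := monic_prod_XsubC (index_iota 0 N.-1) xpredT
    (fun m => - (1 + m%:R) : R).
  by rewrite lead_coefE size_poly_pochhammer.
by rewrite nth_default// size_poly_pochhammer ltn_neqAle jN1 -ltnS prednK.
Qed.

Lemma laguerre_coef_unique (c : node -> R) :
  (forall j, (j < N)%N ->
    \sum_(t : node) c t * Gamma (alpha (tag t) + 1 + (j + tagged t)%:R) =
    if j == N.-1 then 1 else 0) ->
  forall t, c t = laguerre_coef (tag t) (tagged t).
Proof.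
move=> cE; apply: (moment_coef_unique
  (fun t j => Gamma (alpha (tag t) + 1 + (j + tagged t)%:R))
  (fun t => Gamma (node_value t + 1)) (poly_pochhammer 1)).
- by move=> j jN; rewrite size_poly_pochhammer.
(* At -(1 + m) the polynomial (X + 1)_j takes the value (-m)_j, which is 0 for m < j and nonzero for
   m = j. *)
- move=> j m /andP[mj _]; rewrite horner_poly_pochhammer.
  by rewrite opprD addrAC addNr add0r pochhammer_oppn.
- move=> j _; rewrite horner_poly_pochhammer opprD addrAC addNr add0r.
  apply: pochhammer_neq0 => m mj; rewrite addrC subr_eq0 eqr_nat.
  by rewrite neq_ltn mj.
- by move=> t; rewrite gt_eqF// Gamma_gt0// node_value1_gt0.
- move=> t j _; rewrite horner_poly_pochhammer.
  rewrite (_ : _ + 1 + _ = node_value t + 1 + j%:R); last first.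
    by rewrite /node_value natrD; ring.
  by rewrite Gamma_pochhammer// node_value1_gt0.
- by move=> j jN; rewrite cE// laguerre_coef_sum.
Qed.

(** The first Gamma value contains (alpha_i + beta + N)_l, the only factor that depends on both
    [beta] and [l]. *)
Definition jacobi_coef beta i l : R :=
  Gamma (alpha i + l%:R + beta + N%:R) / Gamma (beta + N%:R) *
  (\prod_k pochhammer (alpha k + beta + N%:R) (n k)) * laguerre_coef i l.

Lemma prod_pochhammer_node x :
  \prod_k pochhammer (alpha k + x) (n k) = \prod_(t : node) (node_value t + x).
Proof.
under eq_bigr do rewrite /pochhammer big_mkord.
rewrite (prod_node (fun k m => alpha k + x + m%:R) (fun _ => xpredT)).
by apply: eq_bigr => t _; rewrite addrAC.
Qed.

Lemma pochhammer_opp (x : R) m :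
  pochhammer (- x) m = (-1) ^+ m * pochhammer (x + 1 - m%:R) m.
Proof.
rewrite /pochhammer big_nat_rev/= -[in (-1) ^+ m](subn0 m) -prodr_const_nat -big_split/=.
apply: eq_big_nat => k /andP[_ km].
rewrite add0n mulN1r natrB// -natr1; ring.
Qed.

Definition jacobi_poly beta j : {poly R} :=
  poly_pochhammer 1 j * poly_pochhammer (beta + j%:R + 2) (N.-1 - j).

Lemma horner_jacobi_poly beta j x : (jacobi_poly beta j).[x] =
  pochhammer (x + 1) j * pochhammer (x + (beta + j%:R + 2)) (N.-1 - j).
Proof. by rewrite hornerM !horner_poly_pochhammer. Qed.

Lemma size_jacobi_poly beta j : (j < N)%N -> size (jacobi_poly beta j) = N.
Proof.
move=> jN; rewrite size_mul -?size_poly_eq0 ?size_poly_pochhammer//.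
have N0 : (0 < N)%N by case: N jN.
by rewrite addnS/= addSn subnKC ?prednK// -ltnS prednK.
Qed.

(** The part of the moments independent of j. Taking Gamma(y + beta + N + 1) as common denominator
    leaves a polynomial in y, namely [jacobi_poly]. *)
Definition jacobi_scale beta t : R :=
  Gamma (node_value t + 1) * Gamma (beta + 1) /
  Gamma (node_value t + 1 + beta + N%:R).

Lemma jacobi_moment_poly beta t j : 0 <= beta -> (j < N)%N ->
  Gamma (alpha (tag t) + 1 + (j + tagged t)%:R) * Gamma (beta + 1) /
    Gamma (alpha (tag t) + 1 + (j + tagged t)%:R + (beta + 1)) =
  jacobi_scale beta t * (jacobi_poly beta j).[node_value t].
Proof.
move=> beta0 jN; have y0 := node_value1_gt0 t; have j0 := ler0n R j.
have jN1 : (j <= N.-1)%N by rewrite -ltnS prednK//; case: N jN.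
rewrite horner_jacobi_poly /jacobi_scale.
have -> : alpha (tag t) + 1 + (j + tagged t)%:R = node_value t + 1 + j%:R.
  by rewrite /node_value natrD; ring.
rewrite Gamma_pochhammer//.
have -> : node_value t + 1 + j%:R + (beta + 1) = node_value t + (beta + j%:R + 2).
  by ring.
have z0 : 0 < node_value t + (beta + j%:R + 2) by lra.
have -> : node_value t + 1 + beta + N%:R =
    node_value t + (beta + j%:R + 2) + (N.-1 - j)%:R.
  have -> : N%:R = N.-1%:R + 1 :> R by rewrite natr1 prednK//; case: N jN.
  by rewrite natrB//; ring.
rewrite (Gamma_pochhammer _ (N.-1 - j))//.
have G0 := Gamma_gt0 _ z0; have P0 := pochhammer_gt0 _ (N.-1 - j) z0.
move: (Gamma _) (Gamma _) (Gamma _) G0 => g0 g1 g2 G0.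
by field; rewrite (gt_eqF P0) (gt_eqF G0).
Qed.

Lemma jacobi_coef_sum beta j : 0 <= beta -> (j < N)%N ->
  \sum_(t : node) jacobi_coef beta (tag t) (tagged t) *
    (Gamma (alpha (tag t) + 1 + (j + tagged t)%:R) * Gamma (beta + 1) /
     Gamma (alpha (tag t) + 1 + (j + tagged t)%:R + (beta + 1))) =
  if j == N.-1 then 1 else 0.
Proof.
move=> beta0 jN; have N0 : (0 < N)%N by case: N jN.
have N1 : 1 <= N%:R :> R by rewrite ler1n.
(* Gamma(y + beta + N) in the coefficient over Gamma(y + beta + N + 1) in [jacobi_scale] leaves 1 /
   (y - w). *)
pose w := - (beta + N%:R).
pose Q := \prod_(t : node) (node_value t - w).
have yw t : 0 < node_value t - w by have := node_value1_gt0 t; rewrite /w; lra.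
have Q0 : 0 < Q by apply: prodr_gt0 => t _.
have b1 : 0 < beta + 1 by lra.
have bN : 0 < beta + N%:R by lra.
have wy t : w != node_value t by rewrite -subr_eq0 -opprB oppr_eq0 gt_eqF.
transitivity (Q * Gamma (beta + 1) / Gamma (beta + N%:R) *
    \sum_(t : node) (jacobi_poly beta j).[node_value t] /
      ((node_value t - w) * \prod_(s | s != t) (node_value t - node_value s))).
  rewrite mulr_sumr; apply: eq_bigr => t _.
  rewrite jacobi_moment_poly// /jacobi_coef /jacobi_scale /laguerre_coef.
  rewrite -omegaE -/(node_value t).
  under eq_bigr do rewrite -addrA.
  rewrite prod_pochhammer_node.
  have -> : \prod_(t : node) (node_value t + (beta + N%:R)) = Q.
    by apply: eq_bigr => s _; rewrite opprK.
  have ybN : 0 < node_value t + beta + N%:R by have := yw t; rewrite /w; lra.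
  have -> : node_value t + 1 + beta + N%:R = node_value t + beta + N%:R + 1 by ring.
  rewrite (GammaD1 _ ybN).
  have -> : node_value t - w = node_value t + beta + N%:R by rewrite /w; ring.
  have G0 := Gamma_gt0 _ ybN; have G1 := Gamma_gt0 _ bN.
  have G2 := Gamma_gt0 _ (node_value1_gt0 t).
  have o0 := omega_neq0 (tag t) (tagged t).
  move: (Gamma _) (Gamma _) (Gamma _) G0 G1 G2 => g0 g1 g2 G0 G1 G2.
  by field; rewrite o0 (gt_eqF ybN) (gt_eqF G0) (gt_eqF G1) (gt_eqF G2).
rewrite sum_div_prod_nodes_pole//; last 2 first.
  exact: node_value_inj.
  by rewrite size_jacobi_poly// card_node.
have -> : \prod_(t : node) (w - node_value t) = (-1) ^+ N * Q.
  rewrite -card_node -prodr_const -big_split/=.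
  by apply: eq_bigr => t _; rewrite mulN1r opprB.
rewrite horner_jacobi_poly.
have -> : w + (beta + j%:R + 2) = - (N.-1%:R - j%:R - 1).
  have -> : N.-1%:R = N%:R - 1 :> R by rewrite -[in N%:R](prednK N0) -natr1 addrK.
  by rewrite /w; ring.
have jN1 : (j <= N.-1)%N by rewrite -ltnS prednK.
(* For j < N - 1 the second factor of [jacobi_poly] at w is (-(N - 2 - j))_(N-1-j), which contains a
   zero factor. *)
rewrite -natrB//; case: eqP => [jE|/eqP jN2]; last first.
  have : (0 < N.-1 - j)%N by rewrite subn_gt0 ltn_neqAle jN2.
  case: (N.-1 - j)%N => // k _.
  by rewrite -natr1 addrK pochhammer_oppn// !(mulr0, mul0r, oppr0).
rewrite jE subnn pochhammer0 mulr1.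
have -> : w + 1 = - (beta + N.-1%:R).
  have -> : N.-1%:R = N%:R - 1 :> R by rewrite -[in N%:R](prednK N0) -natr1 addrK.
  by rewrite /w; ring.
(* For j = N - 1 the value at w is (-1)^(N-1) (beta + 1)_(N-1), and this Pochhammer symbol is
   Gamma(beta + N) / Gamma(beta + 1). *)
rewrite pochhammer_opp.
have -> : beta + N.-1%:R + 1 - N.-1%:R = beta + 1 by ring.
have -> : beta + N%:R = beta + 1 + N.-1%:R.
  by rewrite -[in LHS](prednK N0) -natr1; ring.
rewrite Gamma_pochhammer// -[in (-1) ^+ N](prednK N0) exprS mulN1r mulNr invrN.
have P0 := pochhammer_gt0 _ N.-1 b1; have G0 := Gamma_gt0 _ b1.
have S0 : (-1) ^+ N.-1 != 0 :> R by rewrite signr_eq0.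
by field; rewrite S0 (gt_eqF Q0) (gt_eqF P0) (gt_eqF G0).
Qed.

Lemma jacobi_coef_unique beta (c : node -> R) : 0 <= beta ->
  (forall j, (j < N)%N ->
    \sum_(t : node) c t *
      (Gamma (alpha (tag t) + 1 + (j + tagged t)%:R) * Gamma (beta + 1) /
       Gamma (alpha (tag t) + 1 + (j + tagged t)%:R + (beta + 1))) =
    if j == N.-1 then 1 else 0) ->
  forall t, c t = jacobi_coef beta (tag t) (tagged t).
Proof.
move=> beta0 cE; have b1 : 0 < beta + 1 by lra.
apply: (moment_coef_unique
  (fun t j => Gamma (alpha (tag t) + 1 + (j + tagged t)%:R) * Gamma (beta + 1) /
    Gamma (alpha (tag t) + 1 + (j + tagged t)%:R + (beta + 1)))
  (jacobi_scale beta) (jacobi_poly beta)).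
- by move=> j jN; rewrite size_jacobi_poly.
- move=> j m /andP[mj _]; rewrite horner_jacobi_poly.
  by rewrite opprD addrAC addNr add0r pochhammer_oppn ?mul0r.
- move=> j _; rewrite horner_jacobi_poly mulf_neq0//.
    rewrite opprD addrAC addNr add0r.
    apply: pochhammer_neq0 => m mj; rewrite addrC subr_eq0 eqr_nat.
    by rewrite neq_ltn mj.
  (* At -(1 + j) the second factor is (beta + 1)_(N-1-j). *)
  rewrite gt_eqF// pochhammer_gt0//.
  by rewrite [ltRHS](_ : _ = beta + 1)//; ring.
- move=> t; have y0 := node_value1_gt0 t; have N0 := ler0n R N.
  by rewrite /jacobi_scale gt_eqF// divr_gt0 ?mulr_gt0// Gamma_gt0//; lra.
- by move=> t j jN; exact: jacobi_moment_poly.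
- by move=> j jN; rewrite cE// jacobi_coef_sum.
Qed.

End nodes.

(** * Terminating series and closed form of the node products *)

Section closed_forms.
Context {R : realType} {p : nat}.
Variables (alpha : 'I_p -> R) (n : 'I_p -> nat).
Hypothesis alpha_diff : forall i j, i != j -> alpha i - alpha j \isn't a Num.int.
Implicit Types (i k : 'I_p) (l m j : nat) (beta x : R).

Local Notation N := (multi_size n).

(** Since (-d)_l = 0 for l > d, the partial sums are eventually constant. *)
Lemma hypergeometric_terminating (a c : seq R) (d : nat) x :
  hypergeometric (- d%:R :: a) c x =
  \sum_(l < d.+1) (\prod_(u <- - d%:R :: a) pochhammer u l) /
    (\prod_(v <- c) pochhammer v l) * (x ^+ l / l`!%:R).
Proof.
rewrite /hypergeometric; apply: lim_near_cst => //.
exists d.+1 => // m /= dm; rewrite seriesEnat/= (big_cat_nat _ dm)//= big_mkord.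
rewrite [X in _ + X]big1_seq ?addr0// => l.
rewrite mem_index_iota => /and3P[_ dl _].
by rewrite big_cons pochhammer_oppn// !mul0r.
Qed.

(** The nodes are grouped by first index: those of [i] give factorials ([prod_subn_neq]), those of
    each k != i a quotient of Pochhammer symbols ([prod_sub_pochhammer] at x = alpha_k -
    alpha_i). *)
Lemma omega_closed i l : (l < n i)%N ->
  omega alpha n i l =
  (-1) ^+ N.-1 * (-1) ^+ l * l`!%:R * (n i - l.+1)`!%:R *
  (\prod_(k < p | k != i) pochhammer (alpha k - alpha i) (n k)) *
  (\prod_(k < p | k != i) pochhammer (alpha i + 1 - alpha k) l) /
  (\prod_(k < p | k != i) pochhammer (alpha i + 1 - alpha k - (n k)%:R) l).
Proof.
move=> lni; rewrite /omega.
rewrite -(prod_node n (fun k m => alpha i + l%:R - (alpha k + m%:R))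
  (fun k m => alpha k + m%:R != alpha i + l%:R)).
rewrite (bigD1 i)//=.
have -> : \prod_(m < n i | alpha i + m%:R != alpha i + l%:R)
    (alpha i + l%:R - (alpha i + m%:R)) =
    (-1) ^+ (n i - l.+1) * l`!%:R * (n i - l.+1)`!%:R.
  rewrite -prod_subn_neq subnKC// big_mkord; apply: eq_big => m.
    by rewrite (inj_eq (addrI _)) eqr_nat.
  by move=> _; ring.
have -> : \prod_(k < p | k != i) \prod_(m < n k | alpha k + m%:R != alpha i + l%:R)
    (alpha i + l%:R - (alpha k + m%:R)) =
    \prod_(k < p | k != i) ((-1) ^+ n k * pochhammer (alpha k - alpha i) (n k) *
      (pochhammer (alpha i + 1 - alpha k) l /
       pochhammer (alpha i + 1 - alpha k - (n k)%:R) l)).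
  apply: eq_bigr => k ki.
  have ndiff (z : int) : alpha k - alpha i != z%:~R by exact: alpha_diff_neq.
  (* The filter is vacuous: no node of index k != i has the value alpha_i + l. *)
  rewrite (eq_bigl xpredT) => [|m]; last first.
    have := ndiff (l%:Z - m%:Z); rewrite intrB -!pmulrn; apply: contra_neqT.
    by rewrite negbK => /eqP; lra.
  rewrite (_ : alpha i + 1 - alpha k = 1 - (alpha k - alpha i)); last by ring.
  rewrite -prod_sub_pochhammer ?big_mkord.
    by apply: eq_bigr => m _; ring.
  move=> m; have := ndiff (1 - (n k)%:Z + m%:Z).
  by rewrite intrD intrB -!pmulrn; apply: contra_neq; lra.
rewrite !big_split/= prodfV prodrXr.
(* Collects the signs: the exponents n_i - l - 1 and n_k (k != i) add up to N - 1 - l, and (-1)^l is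
   its own inverse. *)
have -> : N.-1 = (n i - l.+1 + l + \sum_(k < p | k != i) n k)%N.
  have ni : n i = (n i - l.+1 + l).+1 by lia.
  by rewrite /multi_size (bigD1 i)//= {1}ni addSn.
rewrite !exprD.
have s2 : (-1) ^+ l * (-1) ^+ l = 1 :> R by rewrite -expr2 sqrr_sign.
ring: s2.
Qed.

End closed_forms.

(** * Type I systems *)

Section typeI_systems.
Context {R : realType} {p : nat}.
Local Notation mu := (@lebesgue_measure R).
Variables (alpha : 'I_p -> R) (n : 'I_p -> nat).
Hypothesis alpha_gtN1 : forall i, -1 < alpha i.
Hypothesis alpha_diff : forall i j, i != j -> alpha i - alpha j \isn't a Num.int.
Implicit Types (i k : 'I_p) (l m j : nat) (beta x : R).

Local Notation N := (multi_size n).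

(** The two sums agree term by term, by [omega_closed] and Gamma(alpha_i + 1 + l) = Gamma(alpha_i +
    1) (alpha_i + 1)_l. *)
Lemma laguerre_coef_hypergeometric i d x : n i = d.+1 ->
  \sum_(l < n i) laguerre_coef alpha n i l * x ^+ l =
  (-1) ^+ N.-1 *
  (d`!%:R^-1 / ((\prod_(k < p | k != i) pochhammer (alpha k - alpha i) (n k)) *
    Gamma (alpha i + 1))) *
  hypergeometric
    (1 - (n i)%:R :: [seq alpha i + 1 - alpha k - (n k)%:R | k <- enum 'I_p & k != i])
    (alpha i + 1 :: [seq alpha i + 1 - alpha k | k <- enum 'I_p & k != i]) x.
Proof.
move=> nid; rewrite (_ : 1 - (n i)%:R = - d%:R); last first.
  by rewrite nid -natr1; ring.
rewrite hypergeometric_terminating mulr_sumr nid; apply: eq_bigr => -[l ld] _ /=.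
rewrite !big_cons !big_map !big_filter !big_enum_cond/=.
have ldE : (l + (d - l))%N = d by rewrite subnKC.
have a1 : 0 < alpha i + 1 by have := alpha_gtN1 i; lra.
have ndiff k (z : int) : k != i -> alpha k - alpha i != z%:~R.
  exact: (alpha_diff_neq alpha alpha_diff).
rewrite /laguerre_coef omega_closed//; last by rewrite nid.
rewrite nid subSS addrAC Gamma_pochhammer//.
have := @pochhammer_fact R (d - l) l; rewrite ldE.
set A := \prod_(k < p | k != i) pochhammer (alpha k - alpha i) (n k).
set B := \prod_(k < p | k != i) pochhammer (alpha i + 1 - alpha k) l.
set C := \prod_(k < p | k != i) pochhammer (alpha i + 1 - alpha k - (n k)%:R) l.
have A0 : A != 0.
  apply/prodf_neq0 => k ki; apply: pochhammer_neq0 => m _.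
  by have := ndiff k (- m%:Z) ki; rewrite intrN -!pmulrn; apply: contra_neq; lra.
have B0 : B != 0.
  apply/prodf_neq0 => k ki; apply: pochhammer_neq0 => m _.
  have := ndiff k (1 + m%:Z) ki; rewrite intrD -!pmulrn; apply: contra_neq; lra.
have C0 : C != 0.
  apply/prodf_neq0 => k ki; apply: pochhammer_neq0 => m _.
  have := ndiff k (1 + m%:Z - (n k)%:Z) ki; rewrite intrB intrD -!pmulrn.
  by apply: contra_neq; lra.
have G0 := Gamma_gt0 _ a1; have P0 := pochhammer_gt0 _ l a1.
have fact_neq0 m : m`!%:R != 0 :> R by rewrite pnatr_eq0 -lt0n fact_gt0.
move: (pochhammer (- d%:R) l) => Pd Pdl.
have {Pdl} -> : Pd = ((-1) ^+ l)^-1 * d`!%:R / (d - l)`!%:R.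
  by apply: (canRL (mulfK (fact_neq0 _))); rewrite invr_sign.
(* The sign is inverted to match the left side, where it stands in the denominator through
   [omega]. *)
rewrite -[in RHS](invr_sign R N.-1).
have S1 : (-1) ^+ l != 0 :> R by rewrite signr_eq0.
have S2 : (-1) ^+ N.-1 != 0 :> R by rewrite signr_eq0.
move: A B C A0 B0 C0 => A B C A0 B0 C0.
move: (Gamma _) (pochhammer _ _) G0 P0 => g P g0 P0.
have [F1 F2 F3] := And3 (fact_neq0 d) (fact_neq0 l) (fact_neq0 (d - l)%N).
by field; rewrite A0 B0 C0 S1 S2 F1 F2 F3 (gt_eqF g0) (gt_eqF P0).
Qed.

(** Turns the integral conditions, for both families of weights, into linear equations in the
    coefficients indexed by the nodes. *)
Lemma typeI_moments (D : set R) (w : 'I_p -> R -> R) (mom : 'I_p -> nat -> R)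
    (L : 'I_p -> {poly R}) j : measurable D ->
  (forall i m, mu.-integrable D (EFin \o (fun x => x ^+ m * w i x)) /\
    \int[mu]_(x in D) (x ^+ m * w i x) = mom i m) ->
  (forall i, (size (L i) <= n i)%N) ->
  \sum_(i < p) \int[mu]_(x in D) (x ^+ j * (L i).[x] * w i x) =
  \sum_(t : node n) (L (tag t))`_(tagged t) * mom (tag t) (j + tagged t)%N.
Proof.
move=> mD wm sL.
rewrite -(sum_node n (fun i l => (L i)`_l * mom i (j + l)%N)).
apply: eq_bigr => i _.
transitivity (\int[mu]_(x in D) (\sum_(l < n i) (L i)`_l * (x ^+ (j + l) * w i x))).
  apply: eq_Rintegral => x _; rewrite (horner_coef_wide _ (sL i)) mulr_sumr mulr_suml.
  by apply: eq_bigr => l _; rewrite exprD; ring.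
have [_ ->] := Rintegral_lincomb D 'I_(n i) (index_enum _)
  (fun l : 'I_(n i) => (L i)`_l) (fun (l : 'I_(n i)) x => x ^+ (j + l) * w i x) mD
  (fun l : 'I_(n i) => (wm i (j + l)%N).1).
by apply: eq_bigr => l _; rewrite (wm i _).2.
Qed.

(** From right to left this gives existence, from left to right uniqueness and the coefficients. *)
Lemma laguerre_typeIP (L : 'I_p -> {poly R}) :
  laguerre_typeI alpha n L <->
  (forall i, (size (L i) <= n i)%N) /\
  (forall t : node n, (L (tag t))`_(tagged t) = laguerre_coef alpha n (tag t) (tagged t)).
Proof.
have E (j : nat) (sL : forall i, (size (L i) <= n i)%N) :=
  typeI_moments `[0, +oo[%classic (fun i x => expR (- x) * x `^ alpha i)
    (fun i m => Gamma (alpha i + 1 + m%:R)) L j (measurable_itv _)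
    (fun i m => laguerre_moment (alpha i) m (alpha_gtN1 i)) sL.
split=> -[sL H]; split=> //; last move=> j jN.
  apply: (laguerre_coef_unique alpha n alpha_gtN1 alpha_diff
    (fun t => (L (tag t))`_(tagged t))) => j jN.
  by rewrite -E// H.
rewrite E// -(laguerre_coef_sum alpha n alpha_gtN1 alpha_diff)//.
by apply: eq_bigr => t _; rewrite H.
Qed.

Lemma jacobi_pineiro_typeI_coef beta (P : 'I_p -> {poly R}) : 0 <= beta ->
  jacobi_pineiro_typeI alpha beta n P ->
  forall t : node n, (P (tag t))`_(tagged t) = jacobi_coef alpha n beta (tag t) (tagged t).
Proof.
move=> beta0 [sP H]; have beta1 : -1 < beta by lra.
apply: (jacobi_coef_unique alpha n alpha_gtN1 alpha_diff beta
  (fun t => (P (tag t))`_(tagged t))) => // j jN.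
rewrite -(typeI_moments `[0, 1]%classic (fun i x => x `^ alpha i * (1 - x) `^ beta)
  (fun i m => Gamma (alpha i + 1 + m%:R) * Gamma (beta + 1) /
    Gamma (alpha i + 1 + m%:R + (beta + 1))) P j (measurable_itv _)
  (fun i m => jacobi_moment (alpha i) beta m (alpha_gtN1 i) beta1) sP).
exact: H.
Qed.

End typeI_systems.

Theorem theorem3 (R : realType) (p : nat) (alpha : 'I_p -> R) (n : 'I_p -> nat)
    (hp : (2 <= p)%N)
    (halpha : forall i, -1 < alpha i)
    (hdiff : forall i j, i != j -> alpha i - alpha j \isn't a Num.int)
    (hn : (1 <= multi_size n)%N) :
  (exists L : 'I_p -> {poly R}, laguerre_typeI alpha n L) /\
  (forall L : 'I_p -> {poly R}, laguerre_typeI alpha n L ->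
     (forall (i : 'I_p) (x : R),
        (L i).[x] =
          (-1) ^+ (multi_size n).-1
          * (inv_fact_pred R (n i)
             / ((\prod_(k < p | k != i) pochhammer (alpha k - alpha i) (n k))
                * Gamma (alpha i + 1)))
          * hypergeometric
              (1 - (n i)%:R
               :: [seq alpha i + 1 - alpha k - (n k)%:R
                  | k <- enum 'I_p & k != i])
              (alpha i + 1
               :: [seq alpha i + 1 - alpha k | k <- enum 'I_p & k != i])
              x) /\
     (forall P : R -> 'I_p -> {poly R},
        (forall beta : R, -1 < beta ->
           jacobi_pineiro_typeI alpha beta n (P beta)) ->
        forall (i : 'I_p) (x : R),
          Gamma (beta + (multi_size n)%:R)
            / ((\prod_(k < p)
                  pochhammer (alpha k + beta + (multi_size n)%:R) (n k))
               * Gamma (alpha i + beta + (multi_size n)%:R))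
            * (P beta i).[x / beta]
          @[beta --> +oo] --> (L i).[x])).
Proof.
split.
  exists (fun i => \poly_(l < n i) laguerre_coef alpha n i l).
  apply/laguerre_typeIP => //; split=> [i|t]; first exact: size_poly.
  by rewrite coef_poly ltn_ord.
move=> L /laguerre_typeIP -/(_ halpha hdiff)[sL LE].
have Lsum i x : (L i).[x] = \sum_(l < n i) laguerre_coef alpha n i l * x ^+ l.
  rewrite (horner_coef_wide _ (sL i)); apply: eq_bigr => l _.
  by have /= <- := LE (Tagged (fun i => 'I_(n i)) l).
split=> [i x|P PE i x]; rewrite Lsum.
  (* For n_i = 0 the sum is empty and [inv_fact_pred] is 0. *)
  case ni : (n i) => [|d]; first by rewrite big_ord0 /= mul0r mulr0 mul0r.
  by have := laguerre_coef_hypergeometric alpha n halpha hdiff i d x ni; rewrite ni.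
set N := multi_size n.
(* The term of degree [l] of the rescaled polynomial at x / beta, with all Gamma factors
   cancelled. *)
pose f (l : nat) (beta : R) := laguerre_coef alpha n i l * x ^+ l *
  (pochhammer (alpha i + N%:R + beta) l / beta ^+ l).
have cf l : f l beta @[beta --> +oo] --> laguerre_coef alpha n i l * x ^+ l.
  rewrite -[X in _ --> X]mulr1; apply: cvgM; first exact: cvg_cst.
  exact: cvg_pochhammer_div.
(* The rescaled polynomial equals this finite sum as soon as beta > 0, so the limit can be taken
   termwise. *)
apply: (@cvg_trans _ ((\sum_(l < n i) f l beta) @[beta --> +oo])); last first.
  by apply: cvg_big => [|l _]; [exact: add_continuous|exact: cf].
apply: near_eq_cvg; near=> beta.
have b0 : 0 < beta by near: beta; exact: nbhs_pinfty_gt.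
have [sP _] : jacobi_pineiro_typeI alpha beta n (P beta) by apply: PE; lra.
have PEcoef := jacobi_pineiro_typeI_coef alpha n halpha hdiff beta (P beta) (ltW b0)
  (PE beta (lt_trans (ltrN10 R) b0)).
have N1 : 1 <= N%:R :> R by rewrite ler1n.
have aN k : 0 < alpha k + beta + N%:R by have := halpha k; lra.
rewrite (horner_coef_wide _ (sP i)) mulr_sumr; apply: eq_bigr => l _.
have /= -> := PEcoef (Tagged (fun i => 'I_(n i)) l).
rewrite /jacobi_coef -/N /f expr_div_n.
rewrite (_ : alpha i + l%:R + beta + N%:R = alpha i + beta + N%:R + l%:R); last by ring.
rewrite (Gamma_pochhammer _ l (aN i)).
rewrite (_ : alpha i + N%:R + beta = alpha i + beta + N%:R); last by ring.
have G0 := Gamma_gt0 _ (aN i).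
have G1 : 0 < Gamma (beta + N%:R) by apply: Gamma_gt0; lra.
have Q0 : 0 < \prod_(k < p) pochhammer (alpha k + beta + N%:R) (n k).
  by apply: prodr_gt0 => k _; exact: pochhammer_gt0.
have B0 : 0 < beta ^+ l by exact: exprn_gt0.
move: (\prod_(k < p) _) (Gamma _) (Gamma _) Q0 G0 G1 => Q g0 g1 Q0 G0 G1.
by field; rewrite (gt_eqF B0) (gt_eqF Q0) (gt_eqF G0) (gt_eqF G1).
Unshelve. all: by end_near. Qed.
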